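(* Let $\mathcal{C} = (S_{\mathcal C}, \Sigma_{\mathcal C}, \mathit{next}_{\mathcal C}, \mathit{leak}_{\mathcal C})$ and $\mathcal{H} = (S_{\mathcal H}, \Sigma_{\mathcal H}, \mathit{next}_{\mathcal H}, \mathit{leak}_{\mathcal H})$ be two transition systems, and let $s_1, s_2 \in S_{\mathcal C}$ and $h_1, h_2 \in S_{\mathcal H}$. Then $$(s_1, s_2, h_1, h_2) \in \mathtt{rbisim} \iff \bigl( [\![ s_1 ]\!]_{\mathcal C} = [\![ s_2 ]\!]_{\mathcal C} \implies [\![ h_1 ]\!]_{\mathcal H} = [\![ h_2 ]\!]_{\mathcal H} \bigr).$$
   Context: A transition system is a tuple $\mathcal T = (S, \Sigma, \mathit{next}, \mathit{leak})$, where $S$ is a set of states, $\Sigma$ is a set of observations, $\mathit{next} : S \to S$ is a transition function and $\mathit{leak} : S \to \Sigma$ is a leakage function. For $s \in S$, the infinite leakage trace $[\![ s ]\!]_{\mathcal T} \in \Sigma^\omega$ is the sequence $\mathit{leak}(s)\ \mathit{leak}(\mathit{next}(s))\ \mathit{leak}(\mathit{next}^2(s)) \ldots$, i.e. its $n$-th element is $\mathit{leak}(\mathit{next}^n(s))$. For a monotone function $F$ on the powerset of a set, $\nu F$ (also $\nu X.\,F(X)$) denotes its greatest fixpoint and $\mu F$ (also $\mu X.\,F(X)$) its least fixpoint. For $R_1 \subseteq S_{\mathcal C} \times S_{\mathcal C} \times S_{\mathcal H} \times S_{\mathcal H}$ define $\mathtt{rbisimF}(R_1) = \mu R_2.\,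 \Psi(R_1,R_2)$, where $\Psi(R_1, R_2)$ is the union of the three sets (C-Leak) $\{ (s_1, s_2, h_1, h_2) \mid \mathit{leak}_{\mathcal C}(s_1) \neq \mathit{leak}_{\mathcal C}(s_2) \}$, (C-Step) $\{ (s_1, s_2, h_1, h_2) \mid (\mathit{next}_{\mathcal C}(s_1), \mathit{next}_{\mathcal C}(s_2), h_1, h_2) \in R_2 \}$, (H-Step) $\{ (s_1, s_2, h_1, h_2) \mid \mathit{leak}_{\mathcal H}(h_1) = \mathit{leak}_{\mathcal H}(h_2) \wedge (s_1, s_2, \mathit{next}_{\mathcal H}(h_1), \mathit{next}_{\mathcal H}(h_2)) \in R_1 \}$. Relative bisimilarity is $\mathtt{rbisim} = \nu R_1.\, \mathtt{rbisimF}(R_1)$. *)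

(* Defs.v *)
From mathcomp Require Import all_boot.
From mathcomp Require Import boolp classical_sets.

Set Implicit Arguments.
Unset Strict Implicit.
Unset Printing Implicit Defensive.

Local Open Scope classical_set_scope.

Record transition_system := TransitionSystem {
  state : Type;
  observation : Type;
  next : state -> state;
  leak : state -> observation
}.

(* An infinite word over Sigma is a function nat -> Sigma. *)
Definition trace (T : transition_system) (s : state T) : nat -> observation T :=
  fun n => leak (iter n (@next T) s).

Section Fixpoints.
Context {U : Type}.
Implicit Types (F : set U -> set U) (X Y : set U).

Definition monotone F := forall X Y, X `<=` Y -> F X `<=` F Y.

(* Knaster-Tarski: for monotone F these are the least and the greatest
   fixpoint of F, see mu_fix, mu_least, nu_fix and nu_greatest. *)
Definition mu F : set U := \bigcap_(X in [set X | F X `<=` X]) X.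
Definition nu F : set U := \bigcup_(X in [set X | X `<=` F X]) X.

Lemma mu_ind F X : F X `<=` X -> mu F `<=` X.
Proof. by move=> FX u; apply. Qed.

Lemma nu_coind F X : X `<=` F X -> X `<=` nu F.
Proof. by move=> XF u Xu; exists X. Qed.

Lemma mu_fix F : monotone F -> F (mu F) = mu F.
Proof.
move=> Fm; have pre : F (mu F) `<=` mu F.
  by move=> u Fu X FX; apply: (FX); apply: Fm Fu; apply: mu_ind.
by apply/seteqP; split => //; apply: mu_ind; apply: Fm.
Qed.

Lemma mu_least F X : F X = X -> mu F `<=` X.
Proof. by move=> FX; apply: mu_ind; rewrite FX. Qed.

Lemma nu_fix F : monotone F -> F (nu F) = nu F.
Proof.
move=> Fm; have post : nu F `<=` F (nu F).
  by move=> u [X XF Xu]; apply: (Fm X); [apply: nu_coind | apply: XF].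
by apply/seteqP; split => //; apply: nu_coind; apply: Fm.
Qed.

Lemma nu_greatest F X : F X = X -> X `<=` nu F.
Proof. by move=> FX; apply: nu_coind; rewrite FX. Qed.

End Fixpoints.

Section RelativeBisimilarity.
Variables C H : transition_system.

Definition quad : Type := (state C * state C * state H * state H)%type.
Implicit Types R : set quad.

Definition c_leak : set quad :=
  [set q | let: (s1, s2, _, _) := q in leak s1 <> leak s2].

Definition c_step R : set quad :=
  [set q | let: (s1, s2, h1, h2) := q in R (next s1, next s2, h1, h2)].

Definition h_step R : set quad :=
  [set q | let: (s1, s2, h1, h2) := q in
    leak h1 = leak h2 /\ R (s1, s2, next h1, next h2)].

Definition Psi R1 R2 : set quad := c_leak `|` c_step R2 `|` h_step R1.

Definition rbisimF R1 : set quad := mu (fun R2 => Psi R1 R2).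

Definition rbisim : set quad := nu rbisimF.

Lemma Psi_monotone R1 R1' R2 R2' :
  R1 `<=` R1' -> R2 `<=` R2' -> Psi R1 R2 `<=` Psi R1' R2'.
Proof.
move=> R11' R22' [[[s1 s2] h1] h2] [[Hleak|Hc]|[eq_leak Hh]].
- by left; left.
- by left; right; apply: R22'.
- by right; split => //; apply: R11'.
Qed.

Lemma rbisimF_monotone : monotone rbisimF.
Proof.
move=> R R' RR' q Fq X FX; apply: Fq => /=.
by apply: subset_trans FX; apply: Psi_monotone.
Qed.

End RelativeBisimilarity.

Arguments rbisim : clear implicits.

(* Main.v *)
(** If the [s]-traces agree, then C-Leak never applies, so every derivation in
    the inner least fixpoint is a finite run of C-Steps ending in an H-Step;
    unfolding the outer greatest fixpoint [n] times compares the [n]-th leaks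
    of [h1] and [h2]. Conversely, the set of quadruples satisfying the
    implication is a post-fixpoint: either both pairs of traces agree and
    H-Step applies, or the [s]-traces first differ at some finite position,
    which C-Steps followed by C-Leak reach. *)
Require Import Defs.
From mathcomp Require Import all_boot.
From mathcomp Require Import boolp classical_sets.

Set Implicit Arguments.
Unset Strict Implicit.
Unset Printing Implicit Defensive.

Local Open Scope classical_set_scope.

Lemma trace_next (T : transition_system) (s : state T) n :
  trace (Defs.next s) n = trace s n.+1.
Proof. by rewrite /trace iterSr. Qed.

Lemma eq_trace_next (T : transition_system) (s t : state T) :
  trace s = trace t -> trace (Defs.next s) = trace (Defs.next t).
Proof. by move=> st; apply/funext => n; rewrite !trace_next st. Qed.

Section RelativeBisimilarityTheory.
Variables C H : transition_system.
Implicit Types (R : set (quad C H)) (s : state C) (h : state H).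

Lemma rbisimF_unfold R : Psi R (rbisimF R) = rbisimF R.
Proof.
by apply: (@mu_fix _ (Psi R)) => R2 R2' R22'; apply: Psi_monotone.
Qed.

Lemma rbisimF_c_leak_at R n s1 s2 h1 h2 :
  trace s1 n <> trace s2 n -> rbisimF R (s1, s2, h1, h2).
Proof.
elim: n s1 s2 => [|n IHn] s1 s2 neq_n; rewrite -rbisimF_unfold; left.
  by left.
by right; apply: IHn; rewrite !trace_next.
Qed.

(** Inversion by induction on the inner fixpoint: [t1], [t2] are the states where the C-Steps stop.
    Their number is forgotten; equal traces suffice for the next unfolding. *)
Lemma rbisimF_eq_trace R s1 s2 h1 h2 :
    rbisimF R (s1, s2, h1, h2) -> trace s1 = trace s2 ->
  leak h1 = leak h2 /\
  exists t1 t2, trace t1 = trace t2 /\ R (t1, t2, Defs.next h1, Defs.next h2).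
Proof.
pose Y : set (quad C H) := [set q | let: (s1, s2, h1, h2) := q in
  trace s1 = trace s2 -> leak h1 = leak h2 /\
    exists t1 t2,
      trace t1 = trace t2 /\ R (t1, t2, Defs.next h1, Defs.next h2)].
suff YP : Psi R Y `<=` Y by move=> /(mu_ind YP).
move=> [[[u1 u2] k1] k2] [[leak_neq|Yu]|[leak_eq Ru]] eq_u.
- by case: leak_neq; apply: (congr1 (fun f => f 0) eq_u).
- exact/Yu/eq_trace_next.
- by split=> //; exists u1, u2.
Qed.

Lemma rbisim_eq_trace s1 s2 h1 h2 :
  rbisim C H (s1, s2, h1, h2) -> trace s1 = trace s2 -> trace h1 = trace h2.
Proof.
move=> bis eq_s; apply/funext => n.
(* All states are generalised, since each unfolding moves [s1], [s2] to unknown [t1], [t2]. *)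
elim: n s1 s2 h1 h2 bis eq_s => [|n IHn] s1 s2 h1 h2;
  rewrite /rbisim -(nu_fix (@rbisimF_monotone C H)) => /rbisimF_eq_trace step
    /step[leak_eq [t1 [t2 [eq_t bis]]]] //.
by rewrite -!trace_next; apply: IHn bis eq_t.
Qed.

Lemma eq_trace_rbisim s1 s2 h1 h2 :
  (trace s1 = trace s2 -> trace h1 = trace h2) -> rbisim C H (s1, s2, h1, h2).
Proof.
pose X : set (quad C H) := [set q | let: (s1, s2, h1, h2) := q in
  trace s1 = trace s2 -> trace h1 = trace h2].
suff XF : X `<=` @rbisimF C H X.
  by move=> eq_sh; apply: (nu_coind XF).
move=> [[[u1 u2] k1] k2] Xu.
have [eq_u|neq_u] := pselect (trace u1 = trace u2).
  (* H-Step at once: the head of [eq_k] gives equal leaks, its tail membership in [X]. *)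
  have eq_k := Xu eq_u; rewrite -rbisimF_unfold; right; split.
    exact: (congr1 (fun f => f 0) eq_k).
  by move=> _; apply: eq_trace_next.
have [n neq_n] : exists n, trace u1 n <> trace u2 n.
  by apply/existsNP => eq_u; apply/neq_u/funext.
exact: rbisimF_c_leak_at neq_n.
Qed.

End RelativeBisimilarityTheory.

Theorem theorem12 (C H : transition_system)
    (s1 s2 : state C) (h1 h2 : state H) :
  rbisim C H (s1, s2, h1, h2) <->
  (trace s1 = trace s2 -> trace h1 = trace h2).
Proof. by split; [apply: rbisim_eq_trace | apply: eq_trace_rbisim]. Qed.
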